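(* Let $r\ge2$ and let $\mathcal{F}\subseteq\binom{[n]}{r}$ be an $r$-uniform family on the fixed ambient set $[n]$. Then there exists a shifted family $\mathcal{H}\subseteq\binom{[n]}{r}$ with $|\mathcal{H}|=|\mathcal{F}|$ such that $$\tfrac12\bigl|\mathcal{F}\,\triangle\,\mathcal{H}\bigr|\ \le\ W(\mathcal{F})-W(\mathcal{H})\ \le\ \mathrm{shdef}(\mathcal{F}).$$ In particular $$\mathrm{dist}_{\mathrm{sh}}(\mathcal{F})\ \le\ \mathrm{shdef}(\mathcal{F}).$$ (Some labels of the ambient set $[n]$ are allowed to occur in no member of $\mathcal{H}$.)
   Context: $[n]=\{1,\dots,n\}$ with its usual order, and $\binom{[n]}{r}$ is the set of $r$-element subsets of $[n]$. $\triangle$ denotes symmetric difference. For $i<j$ in $[n]$ and $F\in\binom{[n]}{r}$ with $j\in F$, $i\notin F$, put $S_{ij}(F)=(F\setminus\{j\})\cup\{i\}$. A family $\mathcal{F}\subseteq\binom{[n]}{r}$ is *shifted* if $S_{ij}(F)\in\mathcal{F}$ whenever $F\in\mathcal{F}$, $i<j$, $j\in F$ and $i\notin F$. For $i<j$ let $N_{ij}(\mathcal{F})=|\{F\in\mathcal{F}: j\in F,\ i\notin F\}|$ and $R_{ij}(\mathcal{F})=|\{F\in\mathcal{F}: j\in F,\ i\notin F,\ S_{ij}(F)\in\mathcal{F}\}|$. The *shifting defect* is $\mathrm{shdef}(\mathcal{F})=\sum_{1\le i<j\le n}\bigl(N_{ij}(\mathcal{F})-R_{ij}(\mathcal{F})\bigr)$.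 The *weight* is $W(\mathcal{F})=\sum_{F\in\mathcal{F}}\sum_{v\in F}v$. The *distance to shiftedness* is $$\mathrm{dist}_{\mathrm{sh}}(\mathcal{F})=\min\Bigl\{\tfrac12|\mathcal{F}\,\triangle\,\mathcal{H}|:\ \mathcal{H}\subseteq\tbinom{[n]}{r}\text{ shifted},\ |\mathcal{H}|=|\mathcal{F}|\Bigr\}.$$ *)

(* Defs.v *)
From mathcomp Require Import all_boot all_order all_algebra.

Set Implicit Arguments.
Unset Strict Implicit.
Unset Printing Implicit Defensive.

Import Order.TTheory GRing.Theory Num.Theory.

(* The ground set [n] = {1, ..., n} is 'I_n: the ordinal v stands for the     *)
(* label v.+1, which only matters in [weight].                                *)

Definition rsets (n r : nat) : {set {set 'I_n}} :=
  [set A : {set 'I_n} | #|A| == r].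

Definition shift (n : nat) (i j : 'I_n) (A : {set 'I_n}) : {set 'I_n} :=
  i |: (A :\ j).

Definition shifted (n : nat) (F : {set {set 'I_n}}) : bool :=
  [forall A in F, forall i : 'I_n, forall j : 'I_n,
     [&& (i < j)%N, j \in A & i \notin A] ==> (shift i j A \in F)].

Definition Nshift (n : nat) (F : {set {set 'I_n}}) (i j : 'I_n) : nat :=
  #|[set A in F | (j \in A) && (i \notin A)]|.

Definition Rshift (n : nat) (F : {set {set 'I_n}}) (i j : 'I_n) : nat :=
  #|[set A in F | [&& j \in A, i \notin A & shift i j A \in F]]|.

Definition weight (n : nat) (F : {set {set 'I_n}}) : nat :=
  (\sum_(A in F) \sum_(v in A) v.+1)%N.

Definition symdiff (T : finType) (A B : {set T}) : {set T} :=
  (A :\: B) :|: (B :\: A).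

Local Open Scope ring_scope.

Definition shdef (n : nat) (F : {set {set 'I_n}}) : rat :=
  \sum_(i < n) \sum_(j < n | (i < j)%N)
     ((Nshift F i j)%:R - (Rshift F i j)%:R).

Definition half_symdiff (n : nat) (F H : {set {set 'I_n}}) : rat :=
  2^-1 * #|symdiff F H|%:R.

Definition sh_competitor (n r : nat) (F H : {set {set 'I_n}}) : bool :=
  [&& H \subset rsets n r, shifted H & #|H| == #|F|].

(* The big operator needs an initial value; #|F| bounds every term, so it     *)
(* does not affect the minimum, see [dist_shP].                               *)
Definition dist_sh (n r : nat) (F : {set {set 'I_n}}) : rat :=
  \big[Num.min/#|F|%:R]_(H : {set {set 'I_n}} | sh_competitor r F H)
     half_symdiff F H.

Lemma half_symdiff_le (n : nat) (F H : {set {set 'I_n}}) :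
  #|H| = #|F| -> half_symdiff F H <= #|F|%:R.
Proof.
move=> eqHF; rewrite /half_symdiff mulrC ler_pdivrMr // -natrM ler_nat.
rewrite muln2 -addnn -[X in (_ <= _ + X)%N]eqHF.
by rewrite (leq_trans (leq_card_setU _ _)) // leq_add // subset_leq_card ?subsetDl.
Qed.

Lemma card_shift (n : nat) (i j : 'I_n) (A : {set 'I_n}) :
  j \in A -> i \notin A -> #|shift i j A| = #|A|.
Proof.
move=> jA iA; rewrite /shift cardsU1 !inE (negbTE iA) andbF.
by rewrite [RHS](cardsD1 j) jA.
Qed.

Lemma sum_shift (n : nat) (i j : 'I_n) (A : {set 'I_n}) :
  (i < j)%N -> j \in A -> i \notin A ->
  (\sum_(v in shift i j A) v.+1 < \sum_(v in A) v.+1)%N.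
Proof.
move=> ij jA iA; rewrite /shift big_setU1 ?inE ?(negbTE iA) ?andbF //=.
by rewrite [X in (_ < X)%N](big_setD1 j) //= ltn_add2r ltnS.
Qed.

Lemma sh_competitor_ex (n r : nat) (F : {set {set 'I_n}}) :
  F \subset rsets n r -> exists H, sh_competitor r F H.
Proof.
move=> FR; pose P (H : {set {set 'I_n}}) := (H \subset rsets n r) && (#|H| == #|F|).
have PF : P F by rewrite /P FR eqxx.
case: (arg_minnP (@weight n) PF) => H /andP[HR /eqP HF] Hmin.
exists H; rewrite /sh_competitor HR HF eqxx andbT /=.
apply/forall_inP => A AH; apply/forallP => i; apply/forallP => j.
apply/implyP => /and3P[ij jA iA]; apply/negPn/negP => BH.
set B := shift i j A in BH; pose K := B |: (H :\ A).
have BK : B \notin H :\ A by rewrite inE (negbTE BH) andbF.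
have /Hmin : P K.
  rewrite /P subUset sub1set inE card_shift // (subset_trans (subsetDl _ _) HR).
  have := subsetP HR _ AH; rewrite inE => ->.
  by rewrite cardsU1 BK -HF [#|H|](cardsD1 A) AH eqxx.
rewrite leqNgt /weight => /negP[].
by rewrite big_setU1 //= [X in (_ < X)%N](big_setD1 A) //= ltn_add2r sum_shift.
Qed.

Lemma dist_shP (n r : nat) (F : {set {set 'I_n}}) : F \subset rsets n r ->
  (exists2 H, sh_competitor r F H & dist_sh r F = half_symdiff F H) /\
  (forall H, sh_competitor r F H -> dist_sh r F <= half_symdiff F H).
Proof.
move=> /sh_competitor_ex[H0 PH0]; split; last by move=> H; apply: bigmin_le_cond.
have [|H PH eH] := @eq_bigmin _ _ _ #|F|%:R _ _ (half_symdiff F) PH0; last by exists H.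
by move=> H /and3P[_ _ /eqP]; apply: half_symdiff_le.
Qed.

(* Main.v *)
Require Import Defs.
From mathcomp Require Import all_boot all_order all_algebra.
From mathcomp Require Import perm zify.
Import Order.TTheory GRing.Theory Num.Theory.
Local Open Scope ring_scope.

(** Compress [F] with adjacent labels [a], [b = a + 1], moving the [k] members
    whose shift is missing. The weight drops by exactly [k], and [F] moves by at
    most [k] sets. The shifting defect drops by at least [k]: its [(a, b)] term
    [k] becomes [0], and the remaining (pair, set) contributions are matched by
    the transposition of [a] and [b]; on each matched pair of sets the
    compression sorts the indicator function of [F], which cannot increase the
    number of downward exits from [F]. Iterating ends at a family closed under
    adjacent shifts, and such a family is shifted. *)

Section AdjacentCompression.

Context {n : nat}.
Implicit Types (F G H : {set {set 'I_n}}) (A B : {set 'I_n}) (a b i j : 'I_n).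

(** * The defect as a count of missing shifts *)

Definition unshifted F i j : {set {set 'I_n}} :=
  [set A in F | [&& j \in A, i \notin A & shift i j A \notin F]].

(** Natural-number form of [shdef]: counting the missing shifts directly avoids subtraction. *)
Definition defect F : nat :=
  (\sum_(p : 'I_n * 'I_n | p.1 < p.2) #|unshifted F p.1 p.2|)%N.

Lemma shdefE F : shdef F = (defect F)%:R.
Proof.
rewrite /shdef /defect pair_big_dep natr_sum; apply: eq_bigr => -[i j] _ /=.
apply/eqP; rewrite subr_eq -natrD eqr_nat; apply/eqP; rewrite /Nshift /Rshift.
rewrite -(cardsID [set A | shift i j A \in F]) addnC; congr (_ + _)%N.
all: apply: eq_card => A; rewrite !inE; case: (A \in F) => //=.
all: by case: (j \in A); case: (i \in A); case: (_ \in F).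
Qed.

(** * Swapping two labels, and compression *)

(** Agrees with [shift a b] on sets with [b] and without [a], but is an involution on all sets, so
    sums can be reindexed by it. *)
Definition swap a b A : {set 'I_n} := tperm a b @^-1: A.

Lemma mem_swap a b A i : (i \in swap a b A) = (tperm a b i \in A).
Proof. by rewrite inE. Qed.

Lemma swapK a b : involutive (swap a b).
Proof. by move=> A; apply/setP => i; rewrite !mem_swap tpermK. Qed.

Lemma mem_imset_swap a b F A : (A \in swap a b @: F) = (swap a b A \in F).
Proof.
by rewrite -[in LHS](swapK a b A) mem_imset //; apply: inv_inj; apply: swapK.
Qed.

Lemma swap_shift a b i j A :
  swap a b (shift i j A) = shift (tperm a b i) (tperm a b j) (swap a b A).
Proof.
apply/setP => v; rewrite !inE.
by rewrite !(can2_eq (tpermK a b) (tpermK a b)).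
Qed.

Lemma swap_shift_id a b A : b \in A -> a \notin A -> swap a b A = shift a b A.
Proof.
move=> bA aA; apply/setP => v; rewrite !inE.
case: tpermP => [->|->|/eqP/negbTE-> /eqP/negbTE->] //.
- by rewrite bA eqxx.
- by rewrite (negbTE aA) eqxx orbF; apply/esym/eqP => eba; rewrite -eba bA in aA.
Qed.

Definition movers F a b : {set {set 'I_n}} :=
  [set A in F | [&& b \in A, a \notin A & swap a b A \notin F]].

Definition compress a b F : {set {set 'I_n}} :=
  (F :\: movers F a b) :|: swap a b @: movers F a b.

Lemma movers_unshifted F a b : movers F a b = unshifted F a b.
Proof.
apply/setP => A; rewrite !inE; case: (boolP (b \in A)) => //= bA.
by case: (boolP (a \in A)) => //= aA; rewrite swap_shift_id.
Qed.

(** When [A] and [swap a b A] differ, the one with [a] receives the disjunction of the two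
    memberships and the other the conjunction: this is the sorting behind [exit_compress]. *)
Lemma mem_compress a b F A : (A \in compress a b F) =
  if a \in A then (A \in F) || (b \notin A) && (swap a b A \in F)
  else (A \in F) && ((b \in A) ==> (swap a b A \in F)).
Proof.
rewrite in_setU mem_imset_swap in_setD !inE swapK tpermL tpermR.
by case: (a \in A); case: (b \in A); case: (A \in F); case: (swap a b A \in F).
Qed.

Lemma card_swap_movers a b F : #|swap a b @: movers F a b| = #|movers F a b|.
Proof. by apply: card_imset; apply: inv_inj; apply: swapK. Qed.

Lemma movers_sub a b F : movers F a b \subset F.
Proof. by apply/subsetP => A; rewrite inE => /andP[]. Qed.

Lemma disjoint_compress a b F :
  [disjoint F :\: movers F a b & swap a b @: movers F a b].
Proof.
rewrite -setI_eq0; apply/eqP/setP => A; rewrite in_setI mem_imset_swap in_setD.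
by rewrite !inE swapK; case: (A \in F); rewrite ?andbF.
Qed.

Lemma card_compress a b F : #|compress a b F| = #|F|.
Proof.
rewrite /compress cardsU disjoint_setI0 ?disjoint_compress // cards0 subn0.
by rewrite card_swap_movers addnC -[RHS](cardsID (movers F a b)) (setIidPr (movers_sub _ _ _)).
Qed.

Lemma compress_sub_rsets r a b F :
  F \subset rsets n r -> compress a b F \subset rsets n r.
Proof.
move=> /subsetP Fr; apply/subsetP => A; rewrite in_setU in_setD => /orP[].
  by move=> /andP[_ /Fr].
case/imsetP => B; rewrite inE => /and4P[/Fr + bB aB _] ->.
by rewrite !inE swap_shift_id // card_shift.
Qed.

(** Only movers leave [F] and only their images enter, whence the factor 2. *)
Lemma card_symdiff_compress a b F :
  (#|symdiff F (compress a b F)| <= 2 * #|movers F a b|)%N.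
Proof.
rewrite mul2n -addnn -[X in (_ <= _ + X)%N](card_swap_movers a b).
apply: leq_trans (leq_card_setU _ _); apply/subset_leq_card/subsetP => A.
rewrite /symdiff /compress !in_setU !in_setD !in_setU !in_setD.
by case: (A \in movers _ _ _); case: (A \in F); case: (A \in _ @: _).
Qed.

Lemma symdiff_triangle (T : finType) (X Y Z : {set T}) :
  (#|symdiff X Z| <= #|symdiff X Y| + #|symdiff Y Z|)%N.
Proof.
apply: leq_trans (leq_card_setU _ _); apply/subset_leq_card/subsetP => x.
by rewrite !inE; case: (x \in X); case: (x \in Y); case: (x \in Z).
Qed.

(** * Effect of one adjacent compression on weight and defect *)

Section Adjacent.

Variables (a b : 'I_n).
Hypothesis ab : b = a.+1 :> nat.

Let ltab : (a < b)%N. Proof. by rewrite ab. Qed.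

(** Adjacency makes the drop exactly one: [b] is traded for [a]. *)
Lemma sum_swap A : b \in A -> a \notin A ->
  (\sum_(v in A) v.+1 = (\sum_(v in swap a b A) v.+1).+1)%N.
Proof.
move=> bA aA; rewrite swap_shift_id // /shift big_setU1 /=; last first.
  by rewrite !inE (negbTE aA) andbF.
by rewrite [LHS](big_setD1 b) //= ab.
Qed.

Lemma weight_compress F : weight F = (weight (compress a b F) + #|movers F a b|)%N.
Proof.
rewrite /weight /compress (big_setID (movers F a b)) (setIidPr (movers_sub _ _ _)).
rewrite [in RHS](eq_bigl _ _ (fun A => in_setU A _ _)) bigU /=; last first.
  exact: disjoint_compress.
rewrite addnC -addnA; congr (_ + _)%N.
rewrite big_imset /=; last by move=> A B _ _; apply: inv_inj; apply: swapK.
rewrite -sum1_card -big_split /=; apply: eq_bigr => A; rewrite inE.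
by case/and4P => _ bA aA _; rewrite addn1 sum_swap.
Qed.

(** No label lies between [a] and [b], so their transposition inverts no other pair. *)
Lemma tperm_lt i j : (i < j)%N -> (i, j) != (a, b) ->
  (tperm a b i < tperm a b j)%N.
Proof.
rewrite xpair_eqE => lij; have eqv (x y : 'I_n) : (x == y) = (x == y :> nat) by [].
rewrite !eqv /tperm; case: (tpermP a b i); case: (tpermP a b j);
  move=> *; subst; lia.
Qed.

Definition exit F (p : 'I_n * 'I_n) A : bool :=
  [&& A \in F, p.2 \in A, p.1 \notin A & shift p.1 p.2 A \notin F].

Definition swap_pair (p : 'I_n * 'I_n) := (tperm a b p.1, tperm a b p.2).

(** Compression sorts the memberships of [A], [swap a b A] and those of their shifts. If both pairs
    are sorted in the same direction, or one of them is constant, the number of places where the set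
    is in the family and its shift is not cannot grow. *)
Lemma exit_compress F (p : 'I_n * 'I_n) A : (p.1 < p.2)%N -> p != (a, b) ->
  (exit (compress a b F) p A + exit (compress a b F) (swap_pair p) (swap a b A)
   <= exit F p A + exit F (swap_pair p) (swap a b A))%N.
Proof.
case: p => i j /= lij nab; rewrite /exit /=.
rewrite !mem_swap !tpermK -swap_shift.
case: (boolP (j \in A)) => jA; rewrite ?andbF //=.
case: (boolP (i \in A)) => iA; rewrite ?andbF //=.
set B := shift i j A.
(* Rules out opposite sorting directions: these would force [(i, j)] to be [(a, b)] or [(b, a)]. *)
have no_cross : (a \in A) && (b \notin A) && (a \notin B) && (b \in B)
   || (a \notin A) && (b \in A) && (a \in B) && (b \notin B) = false.
  apply/negbTE; rewrite !inE.
  case: (boolP (a \in A)) => aA; case: (boolP (b \in A)) => bA //=;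
    rewrite ?andbT ?andbF ?orbF ?negbK.
  - rewrite negb_or negbK; apply/negP => /andP[/andP[_ /eqP ea] /eqP eb].
    by move: lij; rewrite -ea -eb ltnNge ltnW.
  - rewrite negb_or negbK; apply/negP => /andP[/eqP ea /andP[_ /eqP eb]].
    by move: nab; rewrite -ea -eb eqxx.
have fix_swap (X : {set 'I_n}) : (a \in X) = (b \in X) -> swap a b X = X.
  by move=> e; apply/setP => v; rewrite mem_swap; case: tpermP => [->|->|].
rewrite !mem_compress !mem_swap !swapK !tpermL !tpermR.
(* Sets with both or neither of [a], [b] are fixed by the swap; the rest is a check of truth
   values. *)
move: no_cross (fix_swap A) (fix_swap B).
case: (a \in A); case: (b \in A); case: (a \in B); case: (b \in B) => //= _ fA fB;
  try rewrite (fA erefl); try rewrite (fB erefl);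
  by case: (A \in F); case: (swap a b A \in F);
     case: (B \in F); case: (swap a b B \in F).
Qed.

(** A set with [b] and without [a] survives only if its swap was already in [F], and that swap
    stays. *)
Lemma unshifted_compress F : unshifted (compress a b F) a b = set0.
Proof.
rewrite -movers_unshifted; apply/setP => A; rewrite in_set0 in_set.
rewrite !mem_compress !mem_swap swapK tpermL tpermR.
by case: (a \in A); case: (b \in A); case: (A \in F); case: (swap a b A \in F).
Qed.

Lemma card_unshifted F i j : #|unshifted F i j| = (\sum_A exit F (i, j) A)%N.
Proof. by rewrite -sum1dep_card big_mkcond. Qed.

(** Swapping both pair and set permutes the contributions, so a total can be counted a second time
    in the form needed by [exit_compress]. *)
Lemma sum_exit_swap F :
  (\sum_(p : 'I_n * 'I_n | (p.1 < p.2) && (p != (a, b))) \sum_A exit F p A =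
   \sum_(p : 'I_n * 'I_n | (p.1 < p.2) && (p != (a, b)))
      \sum_A exit F (swap_pair p) (swap a b A))%N.
Proof.
have spK : involutive swap_pair by case=> i j; rewrite /swap_pair /= !tpermK.
rewrite (reindex_inj (inv_inj spK)) /=.
have stable (p : 'I_n * 'I_n) : (p.1 < p.2)%N && (p != (a, b)) ->
    ((swap_pair p).1 < (swap_pair p).2)%N && (swap_pair p != (a, b)).
  case: p => i j /= /andP[lij nij]; rewrite tperm_lt //=.
  (* If the swapped pair were [(a, b)], then [(i, j)] would be [(b, a)], against [i < j]. *)
  apply: contraL lij => /eqP e; have := spK (i, j).
  by rewrite e /swap_pair /= tpermL tpermR => -[<- <-]; rewrite -leqNgt ltnW.
apply: eq_big => [p|p _]; last by rewrite (reindex_inj (inv_inj (swapK a b))).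
by apply/idP/idP => [/stable|/stable //]; rewrite spK.
Qed.

Lemma defect_compress F :
  (defect (compress a b F) + #|movers F a b| <= defect F)%N.
Proof.
have split G : defect G = (#|unshifted G a b| +
    \sum_(p : 'I_n * 'I_n | (p.1 < p.2) && (p != (a, b))) \sum_A exit G p A)%N.
  rewrite /defect (bigD1 (a, b)) //=; congr (_ + _)%N.
  by apply: eq_bigr => -[i j] _; rewrite card_unshifted.
rewrite !split unshifted_compress cards0 add0n addnC movers_unshifted leq_add2l.
(* Double both totals and swap one copy on each side, then compare termwise. *)
rewrite -leq_double -!addnn {2}(sum_exit_swap (compress a b F)).
rewrite {2}(sum_exit_swap F) -!big_split /=.
apply: leq_sum => p /andP[lp np]; rewrite -!big_split /=.
by apply: leq_sum => A _; apply: exit_compress.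
Qed.

End Adjacent.

(** * From adjacent shifts to all shifts *)

(** Induction on [j - i]: a longer shift factors through the label [m = i + 1] into an adjacent
    shift and a shorter one. *)
Lemma adjacent_shifted F :
  (forall a b, b = a.+1 :> nat -> movers F a b = set0) -> shifted F.
Proof.
move=> adj.
have adjP a b A : b = a.+1 :> nat -> A \in F -> b \in A -> a \notin A ->
    shift a b A \in F.
  move=> ab AF bA aA; apply/negPn/negP => nF.
  have: A \in movers F a b by rewrite movers_unshifted inE AF bA aA nF.
  by rewrite adj // inE.
suff dist d i j A : (j - i)%N = d.+1 -> A \in F -> j \in A -> i \notin A ->
    shift i j A \in F.
  apply/forall_inP => A AF; apply/forallP => i; apply/forallP => j.
  by apply/implyP => /and3P[ij jA iA]; apply: (dist (j - i).-1) => //; lia.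
elim: d i j A => [|d IH] i j A eji AF jA iA; first by apply: adjP => //; lia.
have mn : (i.+1 < n)%N by have := ltn_ord j; lia.
have [m em] : exists m : 'I_n, m = i.+1 :> nat by exists (Ordinal mn).
have jm : (j - m)%N = d.+1 by lia.
have [mi mj ij] : [/\ m != i, m != j & i != j].
  by split; apply/eqP => /(congr1 val) /=; lia.
(* A label can move to [m] only if [m] is free: when [m] is in [A], send [m] to [i] first and then
   [j] to [m]; otherwise send [j] to [m] first and then [m] to [i]. *)
have [mA|mA] := boolP (m \in A).
- have -> : shift i j A = shift m j (shift i m A).
    apply/setP => v; rewrite !inE; have [->|_] := eqVneq v m.
      by rewrite mj mA orbT.
    by have [->|//] := eqVneq v i; rewrite ij.
  apply: IH => //; first exact: adjP.
    by rewrite !inE jA andbT (eq_sym j m) mj orbT.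
  by rewrite !inE eqxx (negbTE mi).
- have -> : shift i j A = shift i m (shift m j A).
    apply/setP => v; rewrite !inE; have [->|_] //= := eqVneq v m.
    by rewrite (negbTE mA) andbF.
  apply: adjP => //; first exact: IH.
    by rewrite !inE eqxx.
  by rewrite !inE eq_sym (negbTE mi) (negbTE iA) andbF.
Qed.

(** * Iterating the compression *)

(** Strong induction on the weight, which drops at each compression that has movers. The distance
    bound is doubled to stay in [nat]. *)
Lemma compression_limit r F : F \subset rsets n r ->
  exists H, [/\ sh_competitor r F H,
    (#|symdiff F H| + 2 * weight H <= 2 * weight F)%N
    & (weight F <= weight H + defect F)%N].
Proof.
have [w] := ubnP (weight F); elim: w F => // w IH F leF Fr.
have [/existsP[a /existsP[b /andP[/eqP ab K0]]]|noK] :=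
  boolP [exists a : 'I_n, exists b : 'I_n, (b == a.+1 :> nat) && (movers F a b != set0)].
- have k0 : (0 < #|movers F a b|)%N by rewrite card_gt0.
  have wF := weight_compress _ _ ab F; have dF := defect_compress _ _ ab F.
  have sF := card_symdiff_compress a b F.
  have [|H [/and3P[Hr Hs /eqP cH] sH dH]] := IH (compress a b F) _ (compress_sub_rsets r a b F Fr).
    by lia.
  (* Distances add up along the compressions, as do the weight drops that bound them. *)
  have tri := symdiff_triangle _ F (compress a b F) H.
  exists H; split; [|lia|lia].
  by rewrite /sh_competitor Hr Hs cH card_compress eqxx.
(* No adjacent pair has movers, so [F] itself is shifted. *)
- exists F; split; [|by rewrite /symdiff setDv setU0 cards0|exact: leq_addr].
  rewrite /sh_competitor Fr eqxx andbT; apply: adjacent_shifted => a b ab.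
  apply/eqP; move: noK; rewrite negb_exists => /forallP/(_ a).
  by rewrite negb_exists => /forallP/(_ b); rewrite ab eqxx negbK.
Qed.

End AdjacentCompression.

Theorem theorem5p1 (n r : nat) (F : {set {set 'I_n}})
    (r_ge2 : (2 <= r)%N) (F_unif : F \subset rsets n r) :
  (exists H : {set {set 'I_n}},
     [/\ H \subset rsets n r, shifted H, #|H| = #|F|,
         half_symdiff F H <= (weight F)%:R - (weight H)%:R
       & (weight F)%:R - (weight H)%:R <= shdef F])
  /\ dist_sh r F <= shdef F.
Proof.
have [H [FH sH dH]] := compression_limit r F F_unif.
have half_le : half_symdiff F H <= (weight F)%:R - (weight H)%:R.
  rewrite /half_symdiff ler_pdivrMl // mulrBr -!natrM lerBrDr -natrD ler_nat.
  exact: sH.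
have le_def : (weight F)%:R - (weight H)%:R <= shdef F.
  by rewrite shdefE lerBlDl -natrD ler_nat.
split; last first.
  have [_ /(_ H FH) le_dist] := dist_shP F_unif.
  exact: le_trans le_dist (le_trans half_le le_def).
by have /and3P[Hr Hs /eqP cH] := FH; exists H; split.
Qed.
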